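(* Let $\Bbbk$ be a field, let $R=\Bbbk[x_1,\dots,x_m]$, let $I$ be a monomial ideal of $R$, and let $\mathcal{B}=\mathcal{B}(I,\Bbbk)\subseteq\mathbb{Z}^m$ be its Betti poset over $\Bbbk$. Let $\mathcal{P}$ be any subposet of $\mathbb{Z}^m$ such that $\mathcal{B}\subseteq\mathcal{P}\subseteq\deg(I)$. Then the order complex $\Delta(\mathcal{P})$ supports a free resolution of $I$ over $R$.
   Context: $\mathbb{Z}^m$ is partially ordered coordinatewise: $(a_1,\dots,a_m)\le(b_1,\dots,b_m)$ iff $a_i\le b_i$ for all $i$. A subposet is a subset with the induced order. $R=\Bbbk[x_1,\dots,x_m]$ carries its standard $\mathbb{Z}^m$-grading (multigrading), in which $x^\alpha=x_1^{a_1}\cdots x_m^{a_m}$ has degree $\alpha=(a_1,\dots,a_m)$. For $\gamma\in\mathbb{Z}^m$, $R(-\gamma)$ is the free multigraded $R$-module of rank one on a generator of degree $\gamma$. Morphisms of multigraded modules are $R$-linear and homogeneous of degree $0$. For a multigraded $R$-module $M=\bigoplus_{\alpha}M_\alpha$, $\deg(M)=\{\alpha\in\mathbb{Z}^m\mid M_\alpha\neq0\}$. The Betti numbers are $\beta_{d,\alpha}(I)=\dim_\Bbbk\operatorname{Tor}^R_d(I,R/\mathfrak{m})_\alpha$ with $\mathfrak{m}=(x_1,\dots,x_m)$, i.e. the number of basis elements of degree $\alpha$ in homological degree $d$ of the minimal free multigraded resolution of $I$ (as an $R$-module). The Betti poset is $\mathcal{B}(I,\Bbbk)=\{\alpha\in\mathbb{Z}^m\mid\beta_{d,\alpha}(I)\ne0\text{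 for some }d\}$ with the order induced from $\mathbb{Z}^m$. The order complex $\Delta(\mathcal{P})$ is the simplicial complex whose $n$-faces are the strictly increasing chains $A=\{\alpha_0<\dots<\alpha_n\}$ in $\mathcal{P}$, oriented by increasing order of vertices; write $\max A=\alpha_n$. Saying that $\Delta(\mathcal{P})$ supports a free resolution of $I$ means that its homogenization (where each face $A$ is labeled by the degree $\max A$, the join in $\mathbb{Z}^m$ of its vertices) is a free multigraded resolution of $I$ over $R$. Explicitly, this homogenization is the chain complex $G_\bullet$ of free multigraded $R$-modules with $G_n=\bigoplus_{A}R(-\max A)$, the sum being over all $n$-faces $A$ of $\Delta(\mathcal{P})$ ($n\ge0$), with basis elements $e_A$ of degree $\max A$ and differential $$\partial(e_A)=\sum_{i=0}^n(-1)^i\,x^{\max A-\max(A\setminus\{\alpha_i\})}\,e_{A\setminus\{\alpha_i\}}$$ for $n\ge1$; it is a resolution of $I$ if $H_n(G_\bullet)=0$ for $n\neq0$ and $H_0(G_\bullet)\cong I$ as multigraded $R$-modules. *)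

(* Defs.v *)
From HB Require Import structures.
From mathcomp Require Import all_boot all_order all_algebra.
From mathcomp Require Import boolp classical_sets.
From mathcomp Require Import freeg mpoly.

Set Implicit Arguments.
Unset Strict Implicit.
Unset Printing Implicit Defensive.

Import GRing.Theory.

Local Open Scope classical_set_scope.
Local Open Scope ring_scope.
Local Open Scope quotient_scope.

(* Quotients of modules are in the library as Z-modules only; [coker f] is the
   module N / im f. *)
Section Cokernel.
Variables (R : nzRingType) (M N : lmodType R) (f : {linear M -> N}).

Definition im_pred : {pred N} := [pred y | `[< exists x, y = f x >]].

Lemma im_predP y : reflect (exists x, y = f x) (y \in im_pred).
Proof. exact: asboolP. Qed.

Lemma im_zmod_closed : zmod_closed im_pred.
Proof.
split; first by apply/im_predP; exists 0; rewrite linear0.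
move=> _ _ /im_predP[x ->] /im_predP[y ->]; apply/im_predP.
by exists (x - y); rewrite linearB.
Qed.

HB.instance Definition _ := GRing.isZmodClosed.Build N im_pred im_zmod_closed.

Definition coker : Type := Quotient.quot im_pred.

HB.instance Definition _ := GRing.Zmodule.on coker.

Definition to_coker (y : N) : coker := \pi_(Quotient.quot im_pred) y.

Lemma to_coker_eq x y : to_coker x = to_coker y <-> exists z, x - y = f z.
Proof.
split=> [/eqP|h].
  by rewrite /to_coker -Quotient.idealrBE => /im_predP.
by apply/eqP; rewrite /to_coker -Quotient.idealrBE; apply/im_predP.
Qed.

Lemma to_coker_surj (q : coker) : exists x, q = to_coker x.
Proof. by exists (repr q); rewrite /to_coker reprK. Qed.

Lemma to_cokerD x y : to_coker (x + y) = to_coker x + to_coker y.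
Proof. exact: (raddfD (\pi_(Quotient.quot im_pred))). Qed.

Definition coker_scale (a : R) (q : coker) : coker := to_coker (a *: repr q).

Lemma coker_scaleE a x : coker_scale a (to_coker x) = to_coker (a *: x).
Proof.
have : to_coker (repr (to_coker x)) = to_coker x by rewrite /to_coker reprK.
move=> /to_coker_eq[z zE]; apply/to_coker_eq; exists (a *: z).
by rewrite -scalerBr zE linearZ.
Qed.

Lemma coker_scaleA a b q :
  coker_scale a (coker_scale b q) = coker_scale (a * b) q.
Proof. by have [x ->] := to_coker_surj q; rewrite !coker_scaleE scalerA. Qed.

Lemma coker_scale1 : left_id 1 coker_scale.
Proof.
by move=> q; have [x ->] := to_coker_surj q; rewrite coker_scaleE scale1r.
Qed.

Lemma coker_scaleDr : right_distributive coker_scale +%R.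
Proof.
move=> a q r; have [x ->] := to_coker_surj q; have [y ->] := to_coker_surj r.
by rewrite -to_cokerD !coker_scaleE scalerDr to_cokerD.
Qed.

Lemma coker_scaleDl q : {morph coker_scale^~ q : a b / a + b}.
Proof.
move=> a b; have [x ->] := to_coker_surj q.
by rewrite !coker_scaleE scalerDl to_cokerD.
Qed.

HB.instance Definition _ := GRing.Zmodule_isLmodule.Build R coker
  coker_scaleA coker_scale1 coker_scaleDr coker_scaleDl.

Lemma to_cokerZ a x : to_coker (a *: x) = a *: to_coker x.
Proof. by rewrite -coker_scaleE. Qed.

End Cokernel.

Section FreeLift.
Variables (R : nzRingType) (K : choiceType) (M : lmodType R) (f : K -> M).

Definition flift (D : {freeg K / R}) : M := fglift f D.

Lemma flift_is_zmod_morphism : zmod_morphism flift.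
Proof. exact: lift_is_additive. Qed.

HB.instance Definition _ :=
  GRing.isZmodMorphism.Build {freeg K / R} M flift flift_is_zmod_morphism.

Lemma flift_is_scalable : scalable flift.
Proof.
move=> c D; have -> : c *: D = \sum_(z <- dom D) << c * coeff z D *g z >> by [].
rewrite -[in RHS](freeg_sumE D) !raddf_sum /=.
by apply: eq_bigr => b _; rewrite /flift !liftU scalerA.
Qed.

HB.instance Definition _ := GRing.isScalable.Build R {freeg K / R} M *:%R
  flift flift_is_scalable.

End FreeLift.

Section Multigraded.
Variables (k : fieldType) (m : nat).

Local Notation R := {mpoly k[m]}.
Local Notation Zm := {ffun 'I_m -> int}.

Definition mle (a b : Zm) : bool := [forall i, (a i <= b i)%R].
Definition mlt (a b : Zm) : bool := (a != b) && mle a b.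

Definition mnm_deg (u : 'X_{1..m}) : Zm := [ffun i => (u i)%:Z].

(* The exponent b - a; only meaningful when [mle a b]. *)
Definition mnm_sub (b a : Zm) : 'X_{1..m} := [multinom `|b i - a i|%N | i < m].

Definition poly_homog (a : Zm) (f : R) : Prop :=
  forall u, u \in msupp f -> mnm_deg u = a.

Definition monomial_ideal (I : set R) : Prop :=
  exists S : set 'X_{1..m}, I = [set f | exists s : seq (R * 'X_{1..m}),
    (forall x, x \in s -> S x.2) /\ f = \sum_(x <- s) x.1 * 'X_[x.2]].

Definition ideal_deg (I : set R) : set Zm :=
  [set a | exists f, [/\ I f, f != 0 & poly_homog a f]].

(* A sequence ... -> F_1 -> F_0 of free multigraded modules, where F_n is the
   direct sum of R(- bdeg b) over the basis elements b, and the differential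
   F_(n+1) -> F_n is given by its values on the basis. *)
Record free_seq := FreeSeq {
  fbasis : nat -> choiceType;
  bdeg : forall n, fbasis n -> Zm;
  dbasis : forall n, fbasis n.+1 -> {freeg (fbasis n) / R}
}.

Definition fmod (F : free_seq) (n : nat) : lmodType R :=
  {freeg (fbasis F n) / R}.

Definition fdiff (F : free_seq) (n : nat) : {linear fmod F n.+1 -> fmod F n} :=
  flift (@dbasis F n).

Definition fhomog (F : free_seq) (n : nat) (a : Zm) (x : fmod F n) : Prop :=
  forall b, poly_homog (a - bdeg b) (coeff b x).

Definition is_complex (F : free_seq) : Prop :=
  (forall n (b : fbasis F n.+1), fhomog (bdeg b) (dbasis b)) /\
  (forall n x, fdiff F n (fdiff F n.+1 x) = 0).

(* I is not given a type of its own: an isomorphism onto I is an injective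
   linear map to R with image I. *)
Definition iso_H0_ideal (F : free_seq) (I : set R) : Prop :=
  exists phi : {linear coker (fdiff F 0) -> R^o},
    [/\ injective phi,
        range phi = I &
        forall a x, fhomog a x -> poly_homog a (phi (to_coker (fdiff F 0) x))].

Definition free_resolution (F : free_seq) (I : set R) : Prop :=
  [/\ is_complex F,
      forall n x, fdiff F n x = 0 -> exists y, x = fdiff F n.+1 y &
      iso_H0_ideal F I].

(* The submodule m M, with m the ideal generated by the variables. *)
Definition max_mul (M : lmodType R) : set M :=
  [set x | exists y : 'I_m -> M, x = \sum_i ('X_i : R) *: y i].

(* The homology of F (x) R/m = F / m F in homological degree d and internal
   degree a is the quotient of [tor_cycle F d a] by those of its elements that
   are in [tor_bound F d]. *)
Definition tor_cycle (F : free_seq) (d : nat) (a : Zm) : set (fmod F d) :=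
  [set x | fhomog a x /\
    match d return fmod F d -> Prop with
    | 0%N => fun _ => True
    | e.+1 => fun x => max_mul (fdiff F e x)
    end x].

Definition tor_bound (F : free_seq) (d : nat) : set (fmod F d) :=
  [set x | exists y z, max_mul z /\ x = fdiff F d y + z].

(* dim_k Z / (Z `&` B) = n *)
Definition has_quot_dim (M : lmodType R) (Z B : set M) (n : nat) : Prop :=
  exists v : 'I_n -> M,
    [/\ forall i, Z (v i),
        forall c : 'I_n -> k,
          B (\sum_i (c i)%:MP *: v i) -> forall i, c i = 0 &
        forall z, Z z ->
          exists c : 'I_n -> k, B (z - \sum_i (c i)%:MP *: v i)].

(* beta_{d,a}(I) = n. Tor does not depend on the free resolution used. *)
Definition betti_number (I : set R) (d : nat) (a : Zm) (n : nat) : Prop :=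
  exists F, free_resolution F I /\
    has_quot_dim (@tor_cycle F d a) (@tor_bound F d) n.

Definition betti_poset (I : set R) : set Zm :=
  [set a | exists d n, betti_number I d a n /\ n <> 0%N].

Section OrderComplex.
Variable P : set Zm.

Definition chain_set (n : nat) : set {ffun 'I_n.+1 -> Zm} :=
  [set A | (forall i, P (A i)) /\
           (forall i j : 'I_n.+1, (i < j)%N -> mlt (A i) (A j))].

Arguments chain_set n _ : clear implicits.

Definition chain (n : nat) : choiceType := set_type (chain_set n).

(* Chains are increasing, so the last vertex is the maximum. *)
Definition chain_max n (A : chain n) : Zm := val A ord_max.

Lemma face_subproof n (A : chain n.+1) (i : 'I_n.+2) :
  [ffun j => val A (fintype.lift i j)] \in chain_set n.
Proof.
have [PA ltA] := set_mem (valP A).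
apply: mem_set; split=> [j|j l lt_jl]; rewrite !ffunE //.
by apply: ltA; rewrite /= ltnNge leq_bump2 -ltnNge.
Qed.

Definition face n (A : chain n.+1) (i : 'I_n.+2) : chain n :=
  exist (fun A => A \in chain_set n) _ (face_subproof A i).

Definition order_complex : free_seq := {|
  fbasis := chain;
  bdeg := chain_max;
  dbasis n A := \sum_(i < n.+2)
    ((-1) ^+ i * 'X_[mnm_sub (chain_max A) (chain_max (face A i))])
      *: << face A i >>
|}.

End OrderComplex.

Definition supports_free_resolution (P : set Zm) (I : set R) : Prop :=
  free_resolution (order_complex P) I.

End Multigraded.

(* Main.v *)
(* Write Q = deg I.  For P inside Q, the degree g strand of the homogenized order
   complex of P is the simplicial chain complex of the chains of elements of P
   below g, so it is a resolution of I as soon as P_{<= g} is acyclic over k for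
   all g in Q.  This holds for P = Q, where P_{<= g} is a cone with apex g.
   Computing Tor with the resolution given by Q shows that the Betti numbers in
   degree a are those of the reduced homology of Q_{< a}; hence Q_{< q} is acyclic
   for all q in Q outside P.  Building the finite set Q_{<= g} from below, adding
   a maximal element at a time, each q outside P is glued along the acyclic set
   Q_{< q} and does not change the homology, while for q in P one compares
   P_{< q} with Q_{< q} by induction.  So P_{<= g} has the homology of Q_{<= g}. *)
From HB Require Import structures.
From mathcomp Require Import all_boot all_order all_algebra.
From mathcomp Require Import boolp classical_sets.
From mathcomp Require Import freeg mpoly zify.
(* After mpoly, whose mnm_sub would otherwise hide the one of Defs. *)
Require Import Defs.

Set Implicit Arguments.
Unset Strict Implicit.
Unset Printing Implicit Defensive.

Import Order.TTheory GRing.Theory Num.Theory.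

Local Open Scope classical_set_scope.
Local Open Scope ring_scope.

(** * Chains of an ordered set *)

Section FreeModule.
Variables (K : nzRingType) (T : choiceType).
Implicit Types (x y : {freeg T / K}) (X : set T).

Lemma freegP x y : (forall t, coeff t x = coeff t y) <-> x = y.
Proof. by split=> [h|-> //]; apply/eqP/freeg_eqP. Qed.

Lemma freegUE (c : K) (t : T) : << c *g t >> = c *: << t >> :> {freeg T / K}.
Proof. by apply/freegP => u; rewrite coeffZ !coeffU mul1r. Qed.

Lemma freeg_ind (Pr : {freeg T / K} -> Prop) :
  Pr 0 -> (forall x y, Pr x -> Pr y -> Pr (x + y)) ->
  (forall c t, Pr (c *: << t >>)) -> forall x, Pr x.
Proof.
move=> P0 PD PU x; rewrite -(freeg_sumE x).
by apply: big_ind => // t _; rewrite freegUE.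
Qed.

Lemma flift1 (M : lmodType K) (f : T -> M) t : flift f << t >> = f t.
Proof. by rewrite /flift liftU scale1r. Qed.

(** Subcomplexes are cut out of one fixed free module by a support condition, so chains of different
    posets can be added and compared without transport. *)
Definition supp X x := forall t, coeff t x != 0 -> X t.

Lemma supp0 X : supp X 0.
Proof. by move=> t; rewrite coeff0 eqxx. Qed.

Lemma suppD X x y : supp X x -> supp X y -> supp X (x + y).
Proof.
move=> hx hy t; rewrite coeffD; have [->|/hx//] := eqVneq (coeff t x) 0.
by rewrite add0r => /hy.
Qed.

Lemma suppN X x : supp X x -> supp X (- x).
Proof. by move=> hx t; rewrite coeffN oppr_eq0 => /hx. Qed.

Lemma suppB X x y : supp X x -> supp X y -> supp X (x - y).
Proof. by move=> hx /suppN; exact: suppD. Qed.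

Lemma suppZ X (c : K) x : supp X x -> supp X (c *: x).
Proof.
move=> hx t; rewrite coeffZ => cx; apply: hx.
by apply: contraNneq cx => ->; rewrite mulr0.
Qed.

Lemma supp1 X t : X t -> supp X << t >>.
Proof.
by move=> Xt u; rewrite coeffU mul1r; case: (eqVneq t u) => [<-|]; rewrite ?eqxx.
Qed.

Lemma suppS X Y x : X `<=` Y -> supp X x -> supp Y x.
Proof. by move=> XY hx t /hx/XY. Qed.

Lemma supp_eq0 X x : (forall t, ~ X t) -> supp X x -> x = 0.
Proof.
move=> X0 hx; apply/freegP => t; rewrite coeff0; apply/eqP.
by apply: contra_notT (X0 t) => /hx.
Qed.

Lemma supp_ind X (Pr : {freeg T / K} -> Prop) :
  Pr 0 -> (forall x y, Pr x -> Pr y -> Pr (x + y)) ->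
  (forall c t, X t -> Pr (c *: << t >>)) -> forall x, supp X x -> Pr x.
Proof.
move=> P0 PD PU x hx; rewrite -(freeg_sumE x) big_seq.
by apply: big_ind => // t; rewrite mem_dom freegUE => /hx/PU.
Qed.

End FreeModule.

Lemma supp_flift (K : nzRingType) (T T' : choiceType) (X : set T) (Y : set T')
    (f : T -> {freeg T' / K}) x :
  (forall t, X t -> supp Y (f t)) -> supp X x -> supp Y (flift f x).
Proof.
move=> hf; apply: (supp_ind (Pr := fun x => supp Y (flift f x))).
- by rewrite linear0; exact: supp0.
- by move=> u v hu hv; rewrite linearD; exact: suppD.
- by move=> c t Xt; rewrite linearZ /= flift1; apply: suppZ; exact: hf.
Qed.

(** * Augmented chain complexes, cones and relative acyclicity *)

Section Chains.
Variables (K : nzRingType) (T : choiceType) (r : rel T).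
Hypotheses (r_irr : irreflexive r) (r_tr : transitive r).

Local Notation C := {freeg (seq T) / K}.
Implicit Types (s : seq T) (x y : C) (D : set T).

(* Chains are written as decreasing lists, the maximum first, so that removing
   the maximum is structural; the empty chain is included, i.e. chain complexes
   are augmented and [n] is the dimension plus one. *)
Definition dchain n D : set (seq T) :=
  [set s | [/\ sorted r s, size s = n & {in s, forall t, D t}]].

Definition pcons a : C -> C := flift (fun s => << a :: s >> : C).
HB.instance Definition _ a := GRing.Linear.on (pcons a).

(** This is the boundary formula for a cone with apex the first vertex. On a one-element list it
    yields the empty list, which is the augmentation. *)
Fixpoint bnd0 s : C := if s is a :: s' then << s' >> - pcons a (bnd0 s') else 0.

Definition bnd : C -> C := flift bnd0.
HB.instance Definition _ := GRing.Linear.on bnd.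

(** A left inverse of [pcons q]. For [q] maximal it is the projection onto the quotient by the
    chains avoiding [q], identified with the chains below [q]. *)
Definition hd q : C -> C :=
  flift (fun s => if s is a :: t then (if a == q then << t >> else 0) else 0).
HB.instance Definition _ q := GRing.Linear.on (hd q).

Lemma pcons1 a s : pcons a << s >> = << a :: s >>.
Proof. exact: flift1. Qed.

Lemma bnd1 s : bnd << s >> = bnd0 s.
Proof. exact: flift1. Qed.

Lemma bnd_pcons a x : bnd (pcons a x) = x - pcons a (bnd x).
Proof.
elim/freeg_ind: x => [|x y hx hy|c s].
  by rewrite !linear0 addr0.
  by rewrite !linearD /= hx hy addrACA.
by rewrite !linearZ /= -scalerDr pcons1 !bnd1.
Qed.

Lemma bndK x : bnd (bnd x) = 0.
Proof.
elim/freeg_ind: x => [|x y hx hy|c s]; first by rewrite !linear0.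
  by rewrite !linearD /= hx hy addr0.
rewrite !linearZ /= bnd1 (_ : bnd _ = 0) ?scaler0 //.
elim: s => [|a s IH] /=; first by rewrite linear0.
by rewrite linearB /= bnd_pcons IH linear0 subr0 bnd1 subrr.
Qed.

Lemma coeff_pcons a x s :
  coeff s (pcons a x) = if s is b :: t then (a == b)%:R * coeff t x else 0.
Proof.
elim/freeg_ind: x => [|x y hx hy|c u].
- by rewrite linear0 coeff0; case: s => // b t; rewrite coeff0 mulr0.
- rewrite linearD coeffD hx hy {hx hy}.
  by case: s => [|b t]; rewrite ?addr0 // coeffD mulrDr.
- rewrite linearZ /= pcons1 coeffZ coeffU mul1r.
  case: s => [|b t]; first by rewrite mulr0.
  rewrite eqseq_cons coeffZ coeffU mul1r.
  by case: (a == b); rewrite ?mul1r //= mulr0 mul0r.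
Qed.

Lemma coeff_hd q x s : coeff s (hd q x) = coeff (q :: s) x.
Proof.
elim/freeg_ind: x => [|x y hx hy|c u].
- by rewrite linear0 !coeff0.
- by rewrite linearD !coeffD hx hy.
- rewrite linearZ /= !coeffZ; congr (_ * _); rewrite /hd flift1.
  case: u => [|a t]; first by rewrite coeff0 coeffU mul1r.
  by rewrite coeffU eqseq_cons mul1r; case: eqVneq => _; rewrite ?coeff0 // coeffU mul1r.
Qed.

Lemma hd_pcons q x : hd q (pcons q x) = x.
Proof. by apply/freegP => s; rewrite coeff_hd coeff_pcons eqxx mul1r. Qed.

Lemma hd_eq0 (X : set (seq T)) q x : (forall s, ~ X (q :: s)) -> supp X x -> hd q x = 0.
Proof.
move=> hX hx; apply/freegP => s; rewrite coeff_hd coeff0; apply/eqP.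
by apply: contra_notT (hX s) => /hx.
Qed.

Lemma supp_bnd n D x : supp (dchain n D) x -> supp (dchain n.-1 D) (bnd x).
Proof.
apply: supp_flift => s [srt <- sD] t.
(* Faces are subsequences, hence again sorted and with vertices in [D]. *)
suff h : supp [set t | subseq t s /\ size t = (size s).-1] (bnd0 s).
  move=> /h[ts szt]; split=> //; first exact: subseq_sorted srt.
  by move=> u /(mem_subseq ts)/sD.
elim: s {srt sD t} => [|a s IH] /=; first exact: supp0.
apply: suppB; first by apply: supp1; split => //; exact: subseq_cons.
case: s IH => [|b s] IH; first by rewrite /= linear0; exact: supp0.
apply: supp_flift IH => t [ts /= szt].
by apply: supp1; split; rewrite /= ?eqxx ?szt.
Qed.

Lemma supp_pcons n D E a x : D a -> (forall t, E t -> D t /\ r a t) ->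
  supp (dchain n E) x -> supp (dchain n.+1 D) (pcons a x).
Proof.
move=> Da ED; apply: supp_flift => s [srt sz sE]; apply: supp1; split.
- by rewrite /= (path_sortedE r_tr) srt andbT; apply/allP => t /sE/ED[].
- by rewrite /= sz.
- by move=> t; rewrite inE => /orP[/eqP->//|/sE/ED[]].
Qed.

Lemma supp_hd n D a x : supp (dchain n.+1 D) x ->
  supp (dchain n [set t | D t /\ r a t]) (hd a x).
Proof.
move=> hx s; rewrite coeff_hd => /hx[]; rewrite /= (path_sortedE r_tr).
move=> /andP[/allP h1 srt] [sz] hD; split=> // t ts; split; last exact: h1.
by apply: hD; rewrite inE ts orbT.
Qed.

Lemma dchainS n D E : D `<=` E -> dchain n D `<=` dchain n E.
Proof. by move=> DE s [? ? h]; split=> // t /h/DE. Qed.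

(* The head of a chain of D through a maximal element q of D is q. *)
Lemma supp_tail n D q x : (forall d, D d -> ~~ r d q) ->
  supp (dchain n.+1 D) x ->
  supp (dchain n.+1 [set t | D t /\ t != q]) (x - pcons q (hd q x)).
Proof.
move=> qmax hx s; rewrite coeffB coeff_pcons; case: s => [|a s].
  by rewrite subr0 => /hx[].
rewrite coeff_hd; case: (eqVneq q a) => [<-|aq].
  by rewrite mul1r subrr eqxx.
rewrite mul0r subr0 => /hx[srt sz sD]; split=> // t ts; split; first exact: sD.
move: ts; rewrite inE => /orP[/eqP->|ts]; first by rewrite eq_sym.
apply: contraNneq (qmax a (sD a (mem_head _ _))) => <-.
by move: srt; rewrite /= (path_sortedE r_tr) => /andP[/allP/(_ t ts)].
Qed.

(** The case [n = 0] concerns the empty chain, so an acyclic set is nonempty. *)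
Definition acyclic D := forall n x, supp (dchain n D) x -> bnd x = 0 ->
  exists y, supp (dchain n.+1 D) y /\ x = bnd y.

(** Only the chains through [q] matter. Deleting [q] from them leaves chains that [hd q] kills, and
    every other deletion happens behind [q], at the cost of a sign. *)
Lemma hd_bnd n D q x : (forall d, D d -> ~~ r d q) ->
  supp (dchain n.+1 D) x -> hd q (bnd x) = - bnd (hd q x).
Proof.
move=> qmax hx; have [x2 xE h2] : exists2 x2, x = x2 + pcons q (hd q x) &
    supp (dchain n.+1 [set t | D t /\ t != q]) x2.
  by exists (x - pcons q (hd q x)); [rewrite subrK | exact: supp_tail].
rewrite {1}xE !linearD /= bnd_pcons linearB /= hd_pcons.
rewrite (hd_eq0 _ (supp_bnd h2)) ?add0r; last first.
  by move=> s [_ _ /(_ q (mem_head _ _))[_]]; rewrite eqxx.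
rewrite (hd_eq0 _ (supp_hd (a := q) hx)) ?add0r //.
by move=> s [_ _ /(_ q (mem_head _ _))[_]]; rewrite r_irr.
Qed.

(** Coning from [q] is a contracting homotopy. It is applied to the part of [x] avoiding [q]; as [x]
    is a cycle, the boundary of that cone restores the part through [q]. *)
Lemma cone_acyclic D q : D q -> (forall d, D d -> d = q \/ r q d) -> acyclic D.
Proof.
move=> Dq hq n x hx bx.
have qmax d : D d -> ~~ r d q.
  by case/hq => [->|qd]; rewrite ?r_irr //; apply/negP => /(r_tr qd); rewrite r_irr.
case: n hx => [|n] hx.
  exists (pcons q x); split; last by rewrite bnd_pcons bx linear0 subr0.
  apply: (supp_pcons (E := set0)) => //; apply: suppS hx => s [srt sz _].
  by case: s srt sz.
have h2 := supp_tail qmax hx; set x2 := _ - _ in h2.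
exists (pcons q x2); split.
  by apply: supp_pcons h2 => // t [/[dup] Dt /hq[->|//]]; rewrite eqxx.
rewrite bnd_pcons /x2 linearB /= bx bnd_pcons.
have := hd_bnd qmax hx; rewrite bx linear0 => /eqP; rewrite eq_sym oppr_eq0 => /eqP->.
by rewrite linear0 subr0 sub0r linearN /= opprK subrK.
Qed.

Lemma ex_maximal (s : seq T) : s != [::] ->
  exists2 q, q \in s & {in s, forall d, ~~ r d q}.
Proof.
elim: s => // a [|b s] IH _.
  by exists a; rewrite ?mem_head // => d; rewrite inE => /eqP->; rewrite r_irr.
have [//|q qs qmax] := IH; have [raq|raq] := boolP (r a q).
  exists a; rewrite ?mem_head // => d; rewrite inE => /orP[/eqP->|/qmax].
    by rewrite r_irr.
  by apply: contra => /r_tr; apply.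
exists q; first by rewrite inE qs orbT.
by move=> d; rewrite inE => /orP[/eqP->|/qmax].
Qed.

(* Reduced homology does not see the elements [q] of [Q] outside [P]: such a [q],
   maximal in [D], contributes the quotient complex [pcons q] of the chains below
   [q], which is acyclic.  For [q] in [P], the part [x1] of [x] below [q] is
   a relative cycle to which induction applies. *)
Lemma relative_acyclic (P Q : set T) (D : seq T) :
  (forall q, Q q -> ~ P q -> acyclic [set t | Q t /\ r q t]) ->
  {in D, forall d, Q d} -> (forall d e, d \in D -> Q e -> r d e -> e \in D) ->
  forall n x, supp (dchain n [set` D]) x ->
    supp (dchain n.-1 [set t | P t /\ t \in D]) (bnd x) ->
  exists y, supp (dchain n.+1 [set` D]) y /\
    supp (dchain n [set t | P t /\ t \in D]) (x - bnd y).
Proof.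
move=> acy; have [N] := ubnP (size D); elim: N D => // N IH D szD DQ Ddown.
(* The empty chain already is a chain of [P], so nothing has to be corrected. *)
case=> [|n] x hx bx.
  exists 0; split; first exact: supp0.
  rewrite linear0 subr0; apply: suppS hx => s [srt sz _].
  by split=> // t; rewrite (size0nil sz).
have [D0|/ex_maximal[q qD qmax]] := eqVneq D [::].
  exists 0; split; first exact: supp0.
  rewrite linear0 subr0; apply: suppS hx => -[|a s] [srt sz h] //.
  by have := h a (mem_head _ _); rewrite D0.
have qmax' d : [set` D] d -> ~~ r d q by exact: qmax.
set x1 := hd q x; set D1 := [seq t <- D | r q t].
have szD1 : (size D1 < N)%N.
  rewrite -ltnS; apply: leq_trans szD; rewrite ltnS size_filter -(count_predC (r q)).
  by rewrite -addn1 leq_add2l -has_count; apply/hasP; exists q; rewrite //= r_irr.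
have hx1 : supp (dchain n [set` D1]) x1.
  by apply: suppS (supp_hd hx); apply: dchainS => t [/= tD qt]; rewrite mem_filter qt.
have D1E t : Q t /\ r q t <-> t \in D1.
  rewrite mem_filter; split=> [[Qt qt]|/andP[qt /DQ//]].
  by rewrite qt (Ddown q).
have bx1 : bnd x1 = - hd q (bnd x) by rewrite (hd_bnd qmax' hx) opprK.
(* Below [q], the chain [x1] is moved into [P] by a boundary: by induction on [D1] if [q] is in [P],
   and to zero by acyclicity otherwise, where [x1] is a cycle because no chain in [bnd x] contains
   [q]. *)
have [y1 [hy1 hx1y1 qP]] : exists y1, [/\ supp (dchain n.+1 [set` D1]) y1,
    supp (dchain n [set t | P t /\ t \in D1]) (x1 - bnd y1)
    & P q \/ x1 = bnd y1].
  have [Pq|Pq] := pselect (P q).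
    have [||||y1 [? ?]] := IH D1 _ _ _ n x1 hx1 => //.
    - by move=> d; rewrite mem_filter => /andP[_ /DQ].
    - move=> d e /D1E[Qd qd] Qe de; apply/D1E; split => //; exact: r_tr de.
    - rewrite bx1; apply: suppN; case: n {hx1} bx hx => [|n] bx hx.
        rewrite (_ : hd q _ = 0); first exact: supp0.
        by apply: hd_eq0 bx => s [].
      apply: suppS (supp_hd (a := q) bx); apply: dchainS => t /= [[Pt tD] qt].
      by rewrite mem_filter qt.
    - by exists y1; split=> //; left.
  have [||y1 [hy1 x1E]] := acy q (DQ q qD) Pq n x1.
  - by apply: suppS hx1; apply: dchainS => t /D1E.
  - rewrite bx1 (hd_eq0 _ bx) ?oppr0 // => s [_ _ /(_ q (mem_head _ _))[]].
    by [].
  exists y1; split; last by right.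
    by apply: suppS hy1; apply: dchainS => t /D1E.
  by rewrite x1E subrr; exact: supp0.
(* What remains through [q] after the correction: chains of [P], or zero when [q] is outside [P]. *)
set w := pcons q (x1 - bnd y1).
have hw : supp (dchain n.+1 [set t | P t /\ t \in D]) w.
  case: qP => [Pq|x1E]; last by rewrite /w x1E subrr linear0; exact: supp0.
  apply: supp_pcons hx1y1 => // t [Pt].
  by rewrite mem_filter => /andP[].
(* Modulo a boundary and chains of [P], [x] is replaced by [x'], in which all chains through [q]
   cancel; induction then applies to [D] without [q]. *)
set D' := [seq t <- D | t != q]; set x' := x + bnd (pcons q y1) - w.
have D'E : [set` D'] = [set t | [set` D] t /\ t != q].
  by apply/seteqP; split=> t /=; rewrite mem_filter; [move=> /andP[-> ->]|move=> [-> ->]].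
have x'E : x' = x - pcons q (hd q x) + y1.
  by rewrite /x' /w bnd_pcons (linearB (pcons q)) /= opprB !addrA subrK addrAC.
have hx' : supp (dchain n.+1 [set` D']) x'.
  rewrite x'E D'E; apply: suppD; first exact: supp_tail.
  apply: suppS hy1; apply: dchainS => t /=; rewrite mem_filter => /andP[qt tD].
  by split=> //; apply: contraTneq qt => ->; rewrite r_irr.
have [||||y' [hy' hx'y']] := IH D' _ _ _ n.+1 x' hx' => //.
- rewrite size_filter -ltnS; apply: leq_trans szD; rewrite ltnS.
  rewrite -(count_predC (fun t => t != q)) -addn1 leq_add2l -has_count.
  by apply/hasP; exists q => //=; rewrite eqxx.
- by move=> d; rewrite mem_filter => /andP[_ /DQ].
- move=> d e; rewrite !mem_filter => /andP[dq dD] Qe de; rewrite (Ddown d) // andbT.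
  by apply: contraTneq de => ->; exact: qmax.
- have h1 : supp (dchain n [set t | P t /\ t \in D]) (bnd x').
    rewrite /x' linearB linearD /= bndK addr0; apply: suppB => //.
    exact: (supp_bnd hw).
  move=> s cs; have [srt sz h] := h1 s cs.
  have [_ _ h'] := supp_bnd hx' cs.
  by split=> // t ts; split; [case: (h t ts)|exact: h'].
exists (y' - pcons q y1); split.
  apply: suppB; first by apply: suppS hy'; apply: dchainS => t; rewrite D'E => -[].
  apply: supp_pcons hy1 => //= t.
  by rewrite mem_filter => /andP[].
have -> : x - bnd (y' - pcons q y1) = x' - bnd y' + w.
  by rewrite /x' linearB /= opprB addrAC subrK addrA.
apply: suppD => //; apply: suppS hx'y'; apply: dchainS => t [Pt].
by rewrite mem_filter => /andP[].
Qed.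

End Chains.

(** * Multidegrees and strands of the order complex *)

Definition del (T : Type) i (s : seq T) := take i s ++ drop i.+1 s.

Lemma bnd0E (K : nzRingType) (T : choiceType) (s : seq T) :
  bnd0 K s = \sum_(i < size s) (-1) ^+ i *: << del i s >>.
Proof.
elim: s => [|a s IH]; first by rewrite big_ord0.
rewrite big_ord_recl /= expr0 scale1r /del take0 drop1 /=; congr (_ + _).
rewrite IH linear_sum /= -sumrN; apply: eq_bigr => i _.
by rewrite linearZ /= pcons1 exprS mulN1r scaleNr.
Qed.

Lemma size_del (T : Type) i (s : seq T) : (i < size s)%N -> size (del i s) = (size s).-1.
Proof.
move=> lt_i; rewrite size_cat size_take size_drop lt_i; case: (size s) lt_i => // n.
by rewrite ltnS subSS => /subnKC.
Qed.

Lemma nth_del (T : Type) (x0 : T) i (s : seq T) j :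
  (i < size s)%N -> nth x0 (del i s) j = nth x0 s (bump i j).
Proof.
move=> lt_i; rewrite nth_cat size_take lt_i /bump; case: (leqP i j) => ij.
  by rewrite nth_drop addSn subnKC.
by rewrite nth_take.
Qed.

Section Multidegrees.
Variable m : nat.
Local Notation Zm := {ffun 'I_m -> int}.
Implicit Types (a b c : Zm) (u v : 'X_{1..m}).

Lemma mleP a b : reflect (forall i, (a i <= b i)%R) (mle a b).
Proof. exact: forallP. Qed.

Lemma mle_refl a : mle a a.
Proof. exact/mleP. Qed.

Lemma mle_trans b a c : mle a b -> mle b c -> mle a c.
Proof. by move=> /mleP h /mleP g; apply/mleP => i; apply: le_trans (g i). Qed.

Lemma mle_anti a b : mle a b -> mle b a -> a = b.
Proof.
move=> /mleP h /mleP g; apply/ffunP => i; apply/eqP.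
by rewrite eq_le h g.
Qed.

Definition mgt : rel Zm := fun a b => mlt b a.

Lemma mgt_irr : irreflexive mgt.
Proof. by move=> a; rewrite /mgt /mlt eqxx. Qed.

Lemma mgt_trans : transitive mgt.
Proof.
move=> b a c /andP[ba lba] /andP[cb lcb]; rewrite /mgt /mlt (mle_trans lcb lba) andbT.
by apply: contraNneq cb => ca; rewrite ca in lcb *; rewrite (mle_anti lcb lba).
Qed.

Lemma mltW a b : mlt a b -> mle a b.
Proof. by case/andP. Qed.

Lemma mnm_degD u v : mnm_deg (u + v)%MM = mnm_deg u + mnm_deg v.
Proof. by apply/ffunP => i; rewrite !ffunE mnmDE PoszD. Qed.

Lemma mnm_deg0 : mnm_deg 0%MM = 0 :> Zm.
Proof. by apply/ffunP => i; rewrite !ffunE mnm0E. Qed.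

Lemma mnm_deg_inj : injective (@mnm_deg m).
Proof. by move=> u v /ffunP h; apply/mnmP => i; have := h i; rewrite !ffunE => -[]. Qed.

Lemma mle_addl u a : mle a (mnm_deg u + a).
Proof. by apply/mleP => i; rewrite !ffunE lerDr. Qed.

Lemma mnm_subK a b : mle a b -> mnm_deg (mnm_sub b a) + a = b.
Proof.
move=> /mleP h; apply/ffunP => i; rewrite !ffunE mnmE gez0_abs ?subrK //.
by rewrite subr_ge0.
Qed.

Lemma mnm_addK u a : mnm_sub (mnm_deg u + a) a = u.
Proof. by apply/mnm_deg_inj/(addIr a); rewrite mnm_subK ?mle_addl. Qed.

End Multidegrees.

Section Homogeneous.
Variables (k : fieldType) (m : nat) (F : free_seq k m).

Lemma fhomog0 n a : fhomog a (0 : fmod F n).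
Proof. by move=> b u; rewrite coeff0 msupp0. Qed.

Lemma fhomogD n a (x y : fmod F n) : fhomog a x -> fhomog a y -> fhomog a (x + y).
Proof.
move=> hx hy A u; rewrite coeffD => /msuppD_le.
by rewrite mem_cat => /orP[/hx|/hy].
Qed.

Lemma fhomogZ n a (c : k) (x : fmod F n) : fhomog a x -> fhomog a (c%:MP *: x).
Proof. by move=> hx b u; rewrite coeffZ mul_mpolyC => /msuppZ_le/hx. Qed.

End Homogeneous.

Section Strand.
Variables (k : fieldType) (m : nat).
Local Notation R := {mpoly k[m]}.
Local Notation Zm := {ffun 'I_m -> int}.
Local Notation C := {freeg (seq Zm) / k}.
Variable P : set Zm.
Local Notation F := (order_complex k P).

Section Chains.
Variable n : nat.
Implicit Type A : chain P n.

(** The index is reversed because a [chain] increases while a [dchain] decreases. *)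
Definition chain_seq A : seq Zm := [seq val A (inord (n - i)) | i <- iota 0 n.+1].

Lemma size_chain_seq A : size (chain_seq A) = n.+1.
Proof. by rewrite size_map size_iota. Qed.

Lemma nth_chain_seq x0 A i : (i <= n)%N -> nth x0 (chain_seq A) i = val A (inord (n - i)).
Proof. by move=> le_i; rewrite (nth_map 0%N) ?size_iota // nth_iota. Qed.

Lemma chainP A : chain_set P (val A).
Proof. exact: set_mem (valP A). Qed.

Lemma chain_le A i : mle (val A i) (chain_max A).
Proof.
have [_ lt_A] := chainP A.
have [->|ne_i] := eqVneq i ord_max; first exact: mle_refl.
apply/mltW/lt_A; rewrite ltn_neqAle -ltnS ltn_ord andbT.
by apply: contraNneq ne_i => e; apply/eqP/val_inj.
Qed.

Lemma chain_seq_inj : injective chain_seq.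
Proof.
move=> A B AB; apply/val_inj/ffunP => i.
have le_i : (i <= n)%N by rewrite -ltnS.
have := congr1 (fun s => nth 0 s (n - i)) AB.
by rewrite !nth_chain_seq ?leq_subr // subKn // inord_val.
Qed.

Lemma chain_seq_cons A : exists t, chain_seq A = chain_max A :: t.
Proof.
rewrite /chain_seq /= subn0; eexists; congr (_ :: _).
by rewrite /chain_max; congr (val A _); apply: val_inj; rewrite /= inordK.
Qed.

Lemma chain_seq_dchain A (D : set Zm) :
  (forall i, D (val A i)) -> dchain (@mgt m) n.+1 D (chain_seq A).
Proof.
move=> DA; have [_ lt_A] := chainP A; split; last 2 first.
- exact: size_chain_seq.
- by move=> t /mapP[i _ ->].
apply/(sortedP 0) => i; rewrite size_chain_seq => lt_i.
rewrite !nth_chain_seq //; last exact: ltnW.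
apply: lt_A; rewrite !inordK ?ltnS ?leq_subr //.
by rewrite ltn_sub2l.
Qed.

Lemma dchain_chain_seq s : dchain (@mgt m) n.+1 P s -> exists A, chain_seq A = s.
Proof.
move=> [srt sz Ps].
pose f : {ffun 'I_n.+1 -> Zm} := [ffun i : 'I_n.+1 => nth 0 s (n - i)].
have fP : f \in @chain_set m P n.
  apply: mem_set; split=> [i|i j lt_ij]; rewrite !ffunE.
    by apply: Ps; rewrite mem_nth // sz ltnS leq_subr.
  apply: (sorted_ltn_nth (@mgt_trans m)) => //; rewrite ?inE ?sz ?ltnS ?leq_subr //.
  by rewrite ltn_sub2l // (leq_trans lt_ij) // -ltnS.
exists (exist (fun h => h \in @chain_set m P n) f fP).
apply: (@eq_from_nth _ 0); rewrite size_chain_seq ?sz // => i.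
rewrite ltnS => le_i; rewrite nth_chain_seq //= ffunE inordK ?ltnS ?leq_subr //.
by rewrite subKn.
Qed.

End Chains.

Lemma chain_seq_face n (A : chain P n.+1) (i : 'I_n.+2) :
  chain_seq (face A i) = del (n.+1 - i) (chain_seq A).
Proof.
have le_i : (i <= n.+1)%N by rewrite -ltnS.
have sz : (n.+1 - i < size (chain_seq A))%N by rewrite size_chain_seq ltnS leq_subr.
apply: (@eq_from_nth _ 0); first by rewrite size_del // !size_chain_seq.
move=> j; rewrite size_chain_seq ltnS => le_j.
have le_b : (bump (n.+1 - i) j <= n.+1)%N.
  by apply: (@leq_add _ j 1 n) => //; exact: leq_b1.
rewrite nth_del // !nth_chain_seq // ffunE; congr (val A _); apply: val_inj => /=.
rewrite !inordK ?ltnS ?leq_subr // /bump.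
by case: (leqP i (n - j)) => h; case: (leqP (n.+1 - i) j) => h'; lia.
Qed.

(** Reversal turns the face index [i] into [n.+1 - i], so all signs change by one common factor. *)
Lemma bnd_chain_seq n (A : chain P n.+1) :
  bnd << chain_seq A >> =
  (-1) ^+ n.+1 *: \sum_(i < n.+2) (-1) ^+ i *: << chain_seq (face A i) >> :> C.
Proof.
rewrite bnd1 bnd0E size_chain_seq (reindex_inj rev_ord_inj) scaler_sumr.
apply: eq_bigr => i _; rewrite chain_seq_face scalerA /= subSS.
have le_i : (i <= n.+1)%N by rewrite -ltnS.
congr (_ *: _); rewrite -signr_odd -exprD -[RHS]signr_odd oddB // oddD.
by [].
Qed.

Section StrandMap.
Variables (g : Zm) (n : nat).
Implicit Types (x y : fmod F n) (A : chain P n).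

(** The test on [mle] is needed since [mnm_sub] takes absolute values and would otherwise read off
    an unrelated coefficient. *)
Definition strand_coeff A x : k :=
  if mle (chain_max A) g then (coeff A x)@_(mnm_sub g (chain_max A)) else 0.

(* The degree [g] component of [x] with all variables set to 1. *)
Definition strand x : C := \sum_(A <- dom x) strand_coeff A x *: << chain_seq A >>.

Lemma coeff_strand A x : coeff (chain_seq A) (strand x) = strand_coeff A x.
Proof.
rewrite /strand raddf_sum /=.
have [Ax|Ax] := boolP (A \in dom x).
  rewrite (bigD1_seq A) ?uniq_dom //= coeffZ coeffU eqxx !mulr1 big1 ?addr0 // => B BA.
  by rewrite coeffZ coeffU (inj_eq (@chain_seq_inj n)) (negbTE BA) !mulr0.
rewrite big_seq big1 => [|B Bx].
  by rewrite /strand_coeff coeff_outdom // mcoeff0 if_same.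
rewrite coeffZ coeffU (inj_eq (@chain_seq_inj n)) (_ : (B == A) = false) ?mulr0 //.
by apply: contraNF Ax => /eqP<-.
Qed.

Lemma coeff_strand0 s x : ~ (exists A, s = chain_seq A) -> coeff s (strand x) = 0.
Proof.
move=> sA; rewrite /strand raddf_sum big1 // => A _ /=.
rewrite coeffZ coeffU (_ : (_ == s) = false) ?mulr0 //.
by apply/eqP => e; apply: sA; exists A.
Qed.

Lemma strand_is_zmod_morphism : zmod_morphism strand.
Proof.
move=> x y; apply/freegP => s; rewrite coeffB.
have [[A ->]|sA] := pselect (exists A, s = chain_seq A); last first.
  by rewrite !coeff_strand0 ?subr0.
rewrite !coeff_strand /strand_coeff coeffB mcoeffB.
by case: ifP; rewrite ?subr0.
Qed.

HB.instance Definition _ :=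
  GRing.isZmodMorphism.Build (fmod F n) C strand strand_is_zmod_morphism.

Lemma strandC (c : k) x : strand (c%:MP *: x) = c *: strand x.
Proof.
apply/freegP => s; rewrite coeffZ.
have [[A ->]|sA] := pselect (exists A, s = chain_seq A); last first.
  by rewrite !coeff_strand0 ?mulr0.
rewrite !coeff_strand /strand_coeff coeffZ mcoeffCM.
by case: ifP; rewrite ?mulr0.
Qed.

Lemma strand1 (c : k) u A :
  strand ((c *: 'X_[u]) *: << A >>) =
  if g == mnm_deg u + chain_max A then c *: << chain_seq A >> else 0.
Proof.
apply/freegP => s.
have [[B ->]|sA] := pselect (exists A, s = chain_seq A); last first.
  rewrite coeff_strand0 //; case: ifP => _; last by rewrite coeff0.
  rewrite coeffZ coeffU (_ : (_ == s) = false) ?mulr0 //.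
  by apply/eqP => e; apply: sA; exists A.
rewrite coeff_strand /strand_coeff coeffZ coeffU mul1r.
have [->|AB] := eqVneq B A; last first.
  rewrite eq_sym in AB; rewrite mulr0 mcoeff0 if_same.
  case: ifP => _; last by rewrite coeff0.
  by rewrite coeffZ coeffU (inj_eq (@chain_seq_inj n)) (negbTE AB) !mulr0.
rewrite mulr1 mcoeffZ mcoeffX; case: (eqVneq g) => [->|gA].
  by rewrite mle_addl mnm_addK eqxx coeffZ coeffU eqxx !mulr1.
rewrite coeff0; case: ifP => // /mnm_subK h.
rewrite (_ : (u == _) = false) ?mulr0 //; apply: contraNF gA => /eqP->.
by rewrite h.
Qed.

Lemma supp_strand x :
  supp (dchain (@mgt m) n.+1 [set t | P t /\ mle t g]) (strand x).
Proof.
move=> s; have [[A ->]|sA] := pselect (exists A, s = chain_seq A); last first.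
  by rewrite coeff_strand0 ?eqxx.
rewrite coeff_strand /strand_coeff; case: ifP => [Ag _|]; last by rewrite eqxx.
apply: chain_seq_dchain => i; split; first by case: (chainP A).
exact: mle_trans (chain_le A i) Ag.
Qed.

End StrandMap.

Lemma fmod_ind n (Pr : fmod F n -> Prop) :
  Pr 0 -> (forall x y, Pr x -> Pr y -> Pr (x + y)) ->
  (forall c u (A : chain P n), Pr ((c *: 'X_[u]) *: << A >>)) -> forall x, Pr x.
Proof.
move=> P0 PD PU; apply: freeg_ind => // p A.
rewrite [p]mpolyE scaler_suml; exact: big_ind.
Qed.

Lemma strand_coeff_deg n (x : fmod F n) (A : chain P n) u :
  strand_coeff (mnm_deg u + chain_max A) A x = (coeff A x)@_u.
Proof. by rewrite /strand_coeff mle_addl mnm_addK. Qed.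

(** The coefficient of the monomial [u] at [A] appears in the strand of degree
    [mnm_deg u + chain_max A]. *)
Lemma strand_eq0 n (x : fmod F n) : (forall g, strand g x = 0) -> x = 0.
Proof.
move=> h; apply/freegP => A; rewrite coeff0; apply/mpolyP => u.
by rewrite mcoeff0 -strand_coeff_deg -coeff_strand h coeff0.
Qed.

Lemma strand_finite n (x : fmod F n) :
  exists S : seq Zm, forall g, g \notin S -> strand g x = 0.
Proof.
elim/fmod_ind: x => [|x y [S hS] [S' hS']|c u A].
- by exists [::] => g _; rewrite raddf0.
- exists (S ++ S') => g; rewrite mem_cat negb_or => /andP[/hS gS /hS' gS'].
  by rewrite raddfD /= gS gS' addr0.
- exists [:: mnm_deg u + chain_max A] => g; rewrite inE => /negbTE h.
  by rewrite strand1 h.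
Qed.

Lemma fdiff1 n (A : chain P n.+1) : fdiff F n << A >> = dbasis (f := F) A.
Proof. exact: flift1. Qed.

Lemma chain_max_face n (A : chain P n.+1) i : mle (chain_max (face A i)) (chain_max A).
Proof. by rewrite /chain_max ffunE; exact: chain_le. Qed.

(** The monomial in the differential makes up for the drop from the maximum of a chain to that of
    its face, so all terms stay in degree [g] and only the signs survive. *)
Lemma strand_fdiff g n (x : fmod F n.+1) :
  strand g (fdiff F n x) = (-1) ^+ n.+1 *: bnd (strand g x).
Proof.
elim/fmod_ind: x => [|x y hx hy|c u A].
- by rewrite !raddf0 ?scaler0.
- by rewrite !raddfD /= hx hy.
rewrite linearZ /= fdiff1 /= scaler_sumr raddf_sum /=.
transitivity (\sum_(i < n.+2) if g == mnm_deg u + chain_max A then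
    c *: ((-1) ^+ i *: << chain_seq (face A i) >>) else 0 : C).
  apply: eq_bigr => i _; set v := mnm_sub _ _.
  rewrite scalerA (_ : _ * _ = ((-1) ^+ i * c) *: 'X_[u + v]); last first.
    by rewrite mpolyXD mulrCA -!mul_mpolyC mpolyCM rmorphXn /= rmorphN1 !mulrA.
  by rewrite strand1 mnm_degD -addrA mnm_subK ?chain_max_face // scalerA mulrC.
rewrite strand1; case: ifP => _; last by rewrite big1 // linear0 scaler0.
rewrite linearZ /= bnd_chain_seq -!scaler_sumr !scalerA; congr (_ *: _).
by rewrite mulrAC -expr2 sqrr_sign mul1r.
Qed.

Lemma strand_surj g n (y : C) :
  supp (dchain (@mgt m) n.+1 [set t | P t /\ mle t g]) y ->
  exists Y : fmod F n, [/\ fhomog g Y, strand g Y = y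
                         & forall g', g' != g -> strand g' Y = 0].
Proof.
move: y; apply: supp_ind => [|y y' [Y [hY <- Y0]] [Y' [hY' <- Y0']]|c s hs].
- exists 0; split=> [A u||g' _]; rewrite ?raddf0 //.
  by rewrite msupp0.
- exists (Y + Y'); split; [exact: fhomogD | by rewrite raddfD | ].
  by move=> g' g'g; rewrite raddfD /= Y0 // Y0' // addr0.
- have [|A As] := @dchain_chain_seq n s; first by apply: dchainS hs => t [].
  have Ag : mle (chain_max A) g.
    have [t At] := chain_seq_cons A; case: hs => _ _ /(_ (chain_max A)) [] //.
    by rewrite -As At mem_head.
  exists ((c *: 'X_[mnm_sub g (chain_max A)]) *: << A >>); split.
  - move=> B u; rewrite coeffZ coeffU mul1r.
    have [<-|] := eqVneq A B; last by rewrite mulr0 msupp0.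
    rewrite mulr1 => /msuppZ_le; rewrite msuppX inE => /eqP->.
    by apply/eqP; rewrite eq_sym subr_eq mnm_subK.
  - by rewrite strand1 mnm_subK // eqxx As.
  - by move=> g' /negbTE g'g; rewrite strand1 mnm_subK // g'g.
Qed.

(** Finiteness of [S] makes the sum of the homogeneous lifts of the [y g] an element of the
    module. *)
Lemma strand_glue n (S : seq Zm) (y : Zm -> C) :
  (forall g, supp (dchain (@mgt m) n.+1 [set t | P t /\ mle t g]) (y g)) ->
  (forall g, g \notin S -> y g = 0) ->
  exists Y : fmod F n, forall g, strand g Y = y g.
Proof.
move=> hy y0; have [Y hY] := choice (fun g => strand_surj (hy g)).
exists (\sum_(g <- undup S) Y g) => g; rewrite raddf_sum /=.
have [gS|gS] := boolP (g \in S).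
  rewrite (bigD1_seq g) ?undup_uniq ?mem_undup //= big1 ?addr0; first by case: (hY g).
  by move=> d dg; case: (hY d) => _ _; apply; rewrite eq_sym.
rewrite y0 // big_seq big1 // => d; rewrite mem_undup => dS.
by case: (hY d) => _ _; apply; apply: contraNneq gS => ->.
Qed.

Lemma poly_homog_fdiff n (A : fbasis F n.+1) : fhomog (bdeg A) (dbasis A).
Proof.
move=> B u; rewrite raddf_sum /= => /msupp_sum_le /flatten_mapP[i _].
rewrite coeffZ coeffU mul1r; have [<-|] := eqVneq; last by rewrite mulr0 msupp0.
rewrite mulr1 -signr_odd mulr_sign => h.
have : u \in msupp ('X_[mnm_sub (chain_max A) (chain_max (face A i))] : R).
  by move: h; case: odd => //; rewrite (perm_mem (msuppN _)).
rewrite msuppX inE => /eqP->; apply/eqP; rewrite eq_sym subr_eq.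
by rewrite mnm_subK ?chain_max_face.
Qed.

Lemma order_complex_is_complex : is_complex F.
Proof.
split; first exact: poly_homog_fdiff.
move=> n x; apply: strand_eq0 => g.
by rewrite !strand_fdiff linearZ /= bndK !scaler0.
Qed.

End Strand.

(** * From acyclic lower sets to resolutions *)

Section CokernelLift.
Variables (R : nzRingType) (M N L : lmodType R).
Variables (f : {linear M -> N}) (h : {linear N -> L}).
Hypothesis hf0 : forall x, h (f x) = 0.

(** The proof argument, absent from the body, is what lets a linear structure be attached to the
    term [coker_lift hf0]. *)
Definition coker_lift & (forall x, h (f x) = 0) := fun q : coker f => h (repr q).
Local Notation phi := (coker_lift hf0).

Lemma coker_liftE x : phi (to_coker f x) = h x.
Proof.
have : to_coker f (repr (to_coker f x)) = to_coker f x by rewrite /to_coker reprK.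
move=> /to_coker_eq[z zE]; apply/eqP.
by rewrite -subr_eq0 /coker_lift -linearB zE hf0.
Qed.

Lemma coker_lift_is_linear : linear phi.
Proof.
move=> a q q'; have [x ->] := to_coker_surj q; have [y ->] := to_coker_surj q'.
by rewrite -to_cokerZ -to_cokerD !coker_liftE linearP.
Qed.

HB.instance Definition _ :=
  GRing.isLinear.Build R (coker f) L _ phi coker_lift_is_linear.

End CokernelLift.

Section MonomialIdeal.
Variables (k : fieldType) (m : nat) (I : set {mpoly k[m]}).
Local Notation R := {mpoly k[m]}.
Local Notation Zm := {ffun 'I_m -> int}.
Hypothesis monI : monomial_ideal I.

Lemma ideal0 : I 0.
Proof. by case: monI => S ->; exists [::]; rewrite big_nil. Qed.

Lemma idealD f g : I f -> I g -> I (f + g).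
Proof.
case: monI => S -> [s [hs ->]] [t [ht ->]]; exists (s ++ t).
split; last by rewrite big_cat.
by move=> x; rewrite mem_cat => /orP[/hs|/ht].
Qed.

Lemma idealM f g : I g -> I (f * g).
Proof.
case: monI => S -> [s [hs ->]]; exists [seq (f * x.1, x.2) | x <- s]; split.
  by move=> _ /mapP[x /hs Sx ->].
by rewrite big_map mulr_sumr; apply: eq_bigr => x _; rewrite mulrA.
Qed.

(** Every monomial occurring in an element of [I] is a multiple of a generating monomial, hence lies
    in [I]. *)
Lemma ideal_degP a : ideal_deg I a <-> exists2 u, a = mnm_deg u & I 'X_[u].
Proof.
split=> [[f [If f0 fa]]|[u -> Iu]]; last first.
  exists 'X_[u]; split=> //; last by move=> v; rewrite msuppX inE => /eqP->.
  by rewrite -msupp_eq0 msuppX.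
have [u uf] : exists u, u \in msupp f.
  move: f0; rewrite -msupp_eq0; case: (msupp f) => // u s _.
  by exists u; exact: mem_head.
exists u; first by rewrite (fa u uf).
case: monI If uf => S IE; rewrite {1}IE => -[s [hs ->]].
move=> /msupp_sum_le/flatten_mapP[x]; rewrite filter_predT => xs.
move=> /msuppM_le/allpairsP[[v w] /= [_ wx ->]].
move: wx; rewrite msuppX inE => /eqP->; rewrite mpolyXD; apply: idealM.
rewrite IE; exists [:: (1, x.2)]; split; last by rewrite big_seq1 mul1r.
by move=> y; rewrite inE => /eqP->; exact: (hs x).
Qed.

Lemma ideal_deg_up a b : ideal_deg I a -> mle a b -> ideal_deg I b.
Proof.
move=> /ideal_degP[u ->] Iu ub; apply/ideal_degP.
exists (mnm_sub b (mnm_deg u) + u)%MM; first by rewrite mnm_degD mnm_subK.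
by rewrite mpolyXD; exact: idealM.
Qed.

Lemma ideal_deg_finite (g : Zm) :
  exists D : seq Zm, forall a, (a \in D) <-> ideal_deg I a /\ mle a g.
Proof.
(* Degrees of [I] have nonnegative coordinates, so those below [g] lie in the box with side [N]. *)
pose N := (\max_i `|g i|)%N.
pose box := codom (fun f : {ffun 'I_m -> 'I_N.+1} => [ffun i => (f i : nat)%:Z] : Zm).
exists [seq a <- box | `[< ideal_deg I a /\ mle a g >]] => a.
rewrite mem_filter; split=> [/andP[/asboolP//]|h].
apply/andP; split; first exact/asboolP.
case: h => /ideal_degP[u -> _] /mleP ug; apply/codomP.
exists [ffun i => inord (u i)].
apply/ffunP => i; rewrite !ffunE inordK // ltnS.
have := ug i; rewrite ffunE => uig.
apply: leq_trans (leq_bigmax i); lia.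
Qed.

Section Resolution.
Variable P : set Zm.
Hypothesis PI : P `<=` ideal_deg I.
Local Notation F := (order_complex k P).

Definition augmentation : fmod F 0 -> R^o :=
  flift (fun A : chain P 0 => 'X_[mnm_sub (chain_max A) 0] : R^o).
HB.instance Definition _ := GRing.Linear.on augmentation.

Lemma augmentation1 (A : chain P 0) :
  exists u, [/\ chain_max A = mnm_deg u, I 'X_[u] & augmentation << A >> = 'X_[u]].
Proof.
have [PA _] := chainP A; have /ideal_degP[u Au Iu] := PI (PA ord_max).
exists u; split=> //; rewrite /augmentation flift1 /chain_max Au.
by rewrite -{1}(addr0 (mnm_deg u)) mnm_addK.
Qed.

(** The map to [I] becomes, strand by strand, the augmentation of the simplicial complex; this lets
    exactness at homological degree 0 be treated like the others. *)
Lemma bnd_strand0 u (x : fmod F 0) :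
  bnd (strand (mnm_deg u) x) = (augmentation x)@_u *: << [::] >>.
Proof.
elim/fmod_ind: x => [|x y hx hy|c v A].
- by rewrite !raddf0 ?mcoeff0 ?scale0r.
- by rewrite !raddfD /= hx hy -scalerDl.
have [w [Aw _ wE]] := augmentation1 A.
rewrite strand1 Aw -mnm_degD (inj_eq (@mnm_deg_inj m)).
rewrite [augmentation _](_ : _ = c *: 'X_[v + w] :> R); last first.
  by rewrite linearZ /= wE mpolyXD scalerAl.
rewrite mcoeffZ mcoeffX eq_sym.
case: eqVneq => _; last by rewrite linear0 mulr0 scale0r.
rewrite linearZ /= mulr1; congr (_ *: _).
by rewrite bnd1 /chain_seq /= linear0 subr0.
Qed.

Lemma augmentation_fdiff x : augmentation (fdiff F 0 x) = 0.
Proof.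
apply/mpolyP => u; rewrite mcoeff0.
have := bnd_strand0 u (fdiff F 0 x); rewrite strand_fdiff linearZ /= bndK scaler0.
by move=> /(congr1 (coeff [::])); rewrite coeff0 coeffZ coeffU eqxx !mulr1.
Qed.

(** Since deg I is closed upwards, no element of [P] lies below such a [g]. *)
Lemma strand_outside n (x : fmod F n) g : ~ ideal_deg I g -> strand g x = 0.
Proof.
move=> Ig; apply: (supp_eq0 _ (@supp_strand _ _ _ g _ x)) => -[|a s] [_ sz h] //.
by case: (h a (mem_head _ _)) => /PI/ideal_deg_up/[apply].
Qed.

Hypothesis acyP : forall g, ideal_deg I g ->
  acyclic k (@mgt m) [set t | P t /\ mle t g].

(** Primitives are chosen degree by degree, zero outside the finitely many degrees of [x], and
    glued. *)
Lemma strand_exact n (x : fmod F n) :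
  (forall g, bnd (strand g x) = 0) -> exists y, x = fdiff F n y.
Proof.
move=> hx; have [S hS] := strand_finite x.
have /choice[y hy] : forall g, exists y, [/\
    supp (dchain (@mgt m) n.+2 [set t | P t /\ mle t g]) y,
    strand g x = bnd y & g \notin S -> y = 0].
  move=> g; have [gS|/hS gS] := boolP (g \in S); last first.
    by exists 0; split=> //; [exact: supp0 | rewrite gS linear0].
  have [Ig|Ig] := pselect (ideal_deg I g); last first.
    by exists 0; split=> //; [exact: supp0 | rewrite linear0 strand_outside].
  have [y [hy xE]] := acyP Ig (@supp_strand _ _ _ g _ x) (hx g).
  by exists y; split.
(* The sign cancels the one in [strand_fdiff]. *)
have [|| Y hY] := @strand_glue k m P n.+1 S (fun g => (-1) ^+ n.+1 *: y g).
- by move=> g; apply: suppZ; case: (hy g).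
- by move=> g; case: (hy g) => _ _ h /h->; rewrite scaler0.
exists Y; apply/eqP; rewrite -subr_eq0; apply/eqP; apply: strand_eq0 => g.
rewrite raddfB /= (_ : strand g (fdiff F n Y) = strand g x) ?subrr //.
rewrite strand_fdiff hY linearZ /= scalerA -expr2 sqrr_sign scale1r.
by case: (hy g).
Qed.

Lemma range_augmentation f : I f <-> exists x, augmentation x = f.
Proof.
split=> [If|[x <-]]; last first.
  rewrite -(freeg_sumE x) linear_sum; elim/big_ind: _ => [||A _]; first exact: ideal0.
    exact: idealD.
  rewrite freegUE linearZ /=; have [u [_ Iu ->]] := augmentation1 A.
  exact: idealM.
have monic u : I 'X_[u] -> exists x, augmentation x = 'X_[u].
  move=> Iu; have Iu' : ideal_deg I (mnm_deg u) by apply/ideal_degP; exists u.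
  (* Surjectivity onto [I] is acyclicity at the empty chain: it bounds a combination of vertices,
     which lifts to a preimage of the monomial. *)
  have [||y [hy yE]] := acyP Iu' (n := 0) (x := << [::] >>).
  - by apply: supp1; split.
  - by rewrite bnd1.
  have [Y [_ YE Y0]] := strand_surj hy.
  exists Y; apply/mpolyP => v; rewrite mcoeffX.
  have := bnd_strand0 v Y; have [<-|uv] := eqVneq u v.
    rewrite YE -yE => /(congr1 (coeff [::])).
    by rewrite coeffZ !coeffU eqxx !mulr1.
  rewrite Y0 ?linear0 => [/(congr1 (coeff [::]))|].
    by rewrite coeff0 coeffZ coeffU eqxx !mulr1.
  by rewrite (inj_eq (@mnm_deg_inj m)) eq_sym.
case: (monI) If => S IE; rewrite {1}IE => -[s [hs ->]].
rewrite big_seq; elim/big_ind: _ => [|_ _ [x <-] [y <-]|x xs].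
- by exists 0; rewrite linear0.
- by exists (x + y); rewrite linearD.
- have [|y yE] := monic x.2; last by exists (x.1 *: y); rewrite linearZ /= yE.
  rewrite IE; exists [:: (1, x.2)]; split; last by rewrite big_seq1 mul1r.
  by move=> y; rewrite inE => /eqP->; exact: (hs x).
Qed.

Lemma acyclic_free_resolution : free_resolution F I.
Proof.
split; first exact: order_complex_is_complex.
  move=> n x x0; apply: strand_exact => g.
  have := strand_fdiff g x; rewrite x0 raddf0 => /esym/eqP.
  by rewrite scaler_eq0 signr_eq0 => /eqP.
pose phi : {linear coker (fdiff F 0) -> R^o} := coker_lift augmentation_fdiff.
have phiE x : phi (to_coker (fdiff F 0) x) = augmentation x by exact: coker_liftE.
exists phi; split.
- move=> q q'; have [x ->] := to_coker_surj q; have [y ->] := to_coker_surj q'.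
  rewrite !phiE => xy; apply/to_coker_eq.
  apply: strand_exact => g.
  have [Ig|Ig] := pselect (ideal_deg I g); last by rewrite strand_outside ?linear0.
  have /ideal_degP[u -> _] := Ig.
  by rewrite bnd_strand0 linearB /= xy subrr mcoeff0 scale0r.
- apply/seteqP; split=> f.
    move=> [q _ <-]; have [x ->] := to_coker_surj q.
    by rewrite phiE; apply/range_augmentation; exists x.
  move=> /range_augmentation[x <-]; by exists (to_coker (fdiff F 0) x) => //.
- move=> a x hx u; rewrite phiE -(freeg_sumE x) linear_sum.
  move=> /msupp_sum_le/flatten_mapP[A _]; rewrite freegUE linearZ /=.
  have [v [Av _ ->]] := augmentation1 A.
  move=> /msuppM_le/allpairsP[[w w'] /= [/hx wE]].
  rewrite msuppX inE => /eqP-> ->; rewrite mnm_degD wE -Av.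
  by rewrite /= subrK.
Qed.

End Resolution.

End MonomialIdeal.

(** * Betti numbers of the order complex of deg I *)

Lemma seqs_over_finite (T : eqType) (D : seq T) n :
  exists L : seq (seq T), forall s, size s = n -> {in s, forall t, t \in D} -> s \in L.
Proof.
elim: n => [|n [L hL]].
  by exists [:: [::]] => s /size0nil->; rewrite mem_head.
exists [seq a :: s | a <- D, s <- L] => -[|a s] //= [sz] sD.
apply: allpairs_f; first by apply: sD; rewrite mem_head.
by apply: hL => // t ts; apply: sD; rewrite inE ts orbT.
Qed.

(** * Finite dimension of quotients *)

Section QuotDim.
Variables (k : fieldType) (m : nat) (M : lmodType {mpoly k[m]}) (Z B : set M).
Hypothesis Z0 : Z 0.
Hypothesis ZD : forall x y, Z x -> Z y -> Z (x + y).
Hypothesis ZZ : forall (c : k) x, Z x -> Z (c%:MP *: x).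
Hypothesis BZ : forall (c : k) x, B x -> B (c%:MP *: x).

(** A family in [Z] independent modulo [B] has independent images under [psi], hence at most [N]
    members; one of maximal size is a basis of the quotient. *)
Lemma has_quot_dim_ex N (psi : M -> 'rV[k]_N) :
  zmod_morphism psi -> (forall (c : k) x, psi (c%:MP *: x) = c *: psi x) ->
  (forall x, Z x -> psi x = 0 -> B x) -> exists n, has_quot_dim Z B n.
Proof.
move=> psiB psiZ psiI.
pose indep n := exists v : 'I_n -> M, (forall i, Z (v i)) /\
  (forall c : 'I_n -> k, B (\sum_i (c i)%:MP *: v i) -> forall i, c i = 0).
have indep_le n : `[< indep n >] -> (n <= N)%N.
  move=> /asboolP[v [Zv v_indep]].
  pose psiH := HB.pack_for {additive M -> 'rV[k]_N} psi
    (GRing.isZmodMorphism.Build _ _ psi psiB).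
  have psi_sum (c : 'I_n -> k) :
      psi (\sum_i (c i)%:MP *: v i) = \sum_i c i *: psi (v i).
    by rewrite -[psi]/(psiH : M -> _) raddf_sum; apply: eq_bigr => i _; exact: psiZ.
  pose A := \matrix_(i < n) psi (v i).
  suff : row_free A by move=> /eqP<-; exact: rank_leq_col.
  rewrite -kermx_eq0; apply/eqP/matrixP => i j; rewrite [RHS]mxE.
  apply: (v_indep (fun j => kermx A i j)); apply: psiI.
    by elim/big_ind: _ => // l _; exact: ZZ.
  rewrite psi_sum; have /rowP/= := congr1 (row i) (mulmx_ker A) => h.
  apply/rowP => l; have := h l; rewrite !mxE => <-; rewrite summxE.
  by apply: eq_bigr => q _; rewrite !mxE.
have ex_indep : exists n, `[< indep n >].
  by exists 0%N; apply/asboolP; exists (fun=> 0); split=> [|c _] [].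
have [n /asboolP[v [Zv v_indep]] n_max] := ex_maxnP ex_indep indep_le.
exists n, v; split=> // z Zz; apply: contrapT => z_indep.
suff /asboolP/n_max : indep n.+1 by rewrite ltnn.
exists (fun i => if unlift ord_max i is Some j then v j else z); split.
  by move=> i; case: unlift.
move=> c; rewrite big_ord_recr /= unlift_none.
under eq_bigr => i _.
  have -> : widen_ord (leqnSn n) i = fintype.lift ord_max i.
    by apply: val_inj; rewrite [RHS]lift_max.
  rewrite liftK; over.
have [c0|c0] := eqVneq (c ord_max) 0.
  rewrite c0 scale0r addr0 => /v_indep hc i.
  by case: (unliftP ord_max i) => [j ->|->].
move=> /(BZ (c ord_max)^-1); rewrite scalerDr scalerA -mpolyCM mulVf // scale1r addrC.
move=> Bz; exfalso; apply: z_indep.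
(* The dependence relation is solved for [z], whose coefficient [c ord_max] is nonzero. *)
exists (fun i => - ((c ord_max)^-1 * c (fintype.lift ord_max i))).
rewrite -sumrN scaler_sumr in Bz *; move: Bz; congr (B (_ + _)).
by apply: eq_bigr => i _; rewrite mpolyCN scaleNr opprK mpolyCM scalerA.
Qed.

End QuotDim.

Section MaxMul.
Variables (k : fieldType) (m : nat).
Local Notation R := {mpoly k[m]}.

Lemma max_mul0 (M : lmodType R) : @max_mul k m M 0.
Proof. by exists (fun=> 0); rewrite big1 // => i _; rewrite scaler0. Qed.

Lemma max_mulD (M : lmodType R) (x y : M) : max_mul x -> max_mul y -> max_mul (x + y).
Proof.
move=> [u ->] [v ->]; exists (fun i => u i + v i).
by rewrite -big_split; apply: eq_bigr => i _; rewrite scalerDr.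
Qed.

Lemma max_mulZ (M : lmodType R) (p : R) (x : M) : max_mul x -> max_mul (p *: x).
Proof.
move=> [u ->]; exists (fun i => p *: u i).
by rewrite scaler_sumr; apply: eq_bigr => i _; rewrite !scalerA mulrC.
Qed.

Lemma max_mulX (M : lmodType R) u (x : M) : u != 0%MM -> max_mul ('X_[u] *: x).
Proof.
move=> u0; have [i ui] : exists i, u i != 0%N.
  apply/existsP; apply: contraNT u0; rewrite negb_exists => /forallP h.
  by apply/eqP/mnmP => i; rewrite mnm0E; apply/eqP; have := h i; rewrite negbK.
exists (fun j => if j == i then 'X_[u - U_(i)] *: x else 0).
rewrite (bigD1 i) //= eqxx big1 ?addr0 => [|j /negbTE->]; last by rewrite scaler0.
rewrite scalerA -mpolyXD addmC submK //.
by apply/mnm_lepP => j; rewrite mnm1E; case: eqP => // <-; rewrite lt0n.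
Qed.

(** A polynomial lies in the ideal of the variables exactly when its constant term vanishes; this is
    applied coordinatewise. *)
Lemma max_mulP (K : choiceType) (z : {freeg K / R}) :
  max_mul z <-> forall b, (coeff b z)@_0 = 0.
Proof.
split=> [[y ->] b|z0].
  rewrite raddf_sum raddf_sum big1 //= => i _; rewrite coeffZ rmorphM /=.
  by rewrite mcoeffX mnm1_eq0 mul0r.
rewrite -(freeg_sumE z); elim/big_ind: _ => [||b _]; [exact: max_mul0|exact: max_mulD|].
rewrite freegUE [coeff b z]mpolyE scaler_suml big_seq.
elim/big_ind: _ => [||u ub]; [exact: max_mul0|exact: max_mulD|].
rewrite -mul_mpolyC -scalerA; apply/max_mulZ/max_mulX.
by apply: contraTneq ub => ->; rewrite mcoeff_msupp z0 eqxx.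
Qed.

End MaxMul.

(** * Tor in terms of chains strictly below a degree *)

Section Tor.
Variables (k : fieldType) (m : nat).
Local Notation R := {mpoly k[m]}.
Local Notation Zm := {ffun 'I_m -> int}.

Section Closure.
Variable F : free_seq k m.

Lemma tor_cycle0 d a : tor_cycle a (0 : fmod F d).
Proof.
split; first exact: fhomog0.
by case: d => // d; rewrite linear0; exact: max_mul0.
Qed.

Lemma tor_cycleD d a (x y : fmod F d) :
  tor_cycle a x -> tor_cycle a y -> tor_cycle a (x + y).
Proof.
case: d x y => [|d] x y [hx cx] [hy cy]; split; try exact: fhomogD; first by [].
by rewrite linearD; exact: max_mulD.
Qed.

Lemma tor_cycleZ d a (c : k) (x : fmod F d) : tor_cycle a x -> tor_cycle a (c%:MP *: x).
Proof.
case: d x => [|d] x [hx cx]; split; try exact: fhomogZ; first by [].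
by rewrite linearZ; exact: max_mulZ.
Qed.

Lemma tor_boundZ d (c : k) (x : fmod F d) : tor_bound x -> tor_bound (c%:MP *: x).
Proof.
move=> [y [z [hz ->]]]; exists (c%:MP *: y), (c%:MP *: z); split; first exact: max_mulZ.
by rewrite linearZ scalerDr.
Qed.

End Closure.

Variable I : set R.
Hypothesis monI : monomial_ideal I.
Local Notation Q := (ideal_deg I).
Local Notation F := (order_complex k Q).

Lemma not_mgt_le (a b : Zm) : mle b a -> ~~ mgt b a.
Proof.
by move=> ba; apply/negP => /andP[ab lab]; rewrite (mle_anti ba lab) eqxx in ab. Qed.

Lemma ideal_deg_acyclic g : Q g -> acyclic k (@mgt m) [set t | Q t /\ mle t g].
Proof.
move=> Qg; apply: (cone_acyclic (@mgt_irr m) (@mgt_trans m) (q := g)).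
  by split=> //; exact: mle_refl.
move=> d [_ dg]; have [->|ne] := eqVneq d g; first by left.
by right; rewrite /mgt /mlt ne.
Qed.

Lemma fhomog_strand n a g (x : fmod F n) : fhomog a x -> g != a -> strand g x = 0.
Proof.
move=> hx ga; apply/freegP => s; rewrite coeff0.
have [[A ->]|sA] := pselect (exists A : chain Q n, s = chain_seq A); last first.
  by rewrite coeff_strand0.
rewrite coeff_strand /strand_coeff; case: ifP => // Ag.
apply/memN_msupp_eq0; apply: contra ga => /hx h.
by rewrite -(mnm_subK Ag) h subrK.
Qed.

(** A constant coefficient at [A] sits in degree [chain_max A], so in internal degree [a] reduction
    modulo the variables sees only the chains with maximum [a]. *)
Lemma mcoeff0_strand n (x : fmod F n) (A : chain Q n) :
  (coeff A x)@_0 = coeff (chain_seq A) (strand (chain_max A) x).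
Proof. by rewrite coeff_strand -[chain_max A]add0r -mnm_deg0 strand_coeff_deg. Qed.

(* [betti_number] is only defined when the quotient has finite dimension, so
   vanishing of Tor requires finiteness in each degree first. *)
Lemma tor_has_dim d a :
  exists n, has_quot_dim (@tor_cycle k m F d a) (@tor_bound k m F d) n.
Proof.
have [D hD] := ideal_deg_finite monI a.
have [L hL] := seqs_over_finite D d.+1.
(* A homogeneous element of degree [a] is determined by its strand there, which has coordinates at
   the finitely many lists in [L]. *)
apply: (has_quot_dim_ex (@tor_cycle0 F d a) (@tor_cycleD F d a) (@tor_cycleZ F d a)
  (@tor_boundZ F d)
  (psi := fun x => \row_(j < size L) coeff (nth [::] L j) (strand a x))).
- by move=> x y; apply/rowP => j; rewrite !mxE raddfB /= coeffB.
- by move=> c x; apply/rowP => j; rewrite !mxE strandC coeffZ.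
move=> x [hx _] x0; suff -> : x = 0.
  by exists 0, 0; split; [exact: max_mul0 | rewrite linear0 addr0].
apply: strand_eq0 => g; have [->|ga] := eqVneq g a; last exact: fhomog_strand ga.
apply/freegP => s; rewrite coeff0; apply/eqP; apply: contraT => sx.
have /(@supp_strand _ _ _ a _ x)[_ sz sQ] := sx.
have sL : s \in L by apply: hL => // t /sQ/hD.
have /rowP/(_ (Ordinal (etrans (index_mem s L) sL))) := x0.
by rewrite !mxE /= nth_index // => /eqP; rewrite (negbTE sx).
Qed.

(* In degree [a], tensoring with R/m kills exactly the part of the differential
   that removes the vertex [a]; the cycles are the cones [pcons a x] over the
   cycles [x] of the chains below [a]. *)
Lemma betti_acyclic a : Q a -> ~ betti_poset I a ->
  acyclic k (@mgt m) [set t | Q t /\ mgt a t].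
Proof.
move=> Qa nBa d x hx bx.
have resF : free_resolution F I.
  by apply: acyclic_free_resolution => // g; exact: ideal_deg_acyclic.
have hax : supp (dchain (@mgt m) d.+1 [set t | Q t /\ mle t a]) (pcons a x).
  apply: (supp_pcons (@mgt_trans m) _ _ hx); first by split=> //; exact: mle_refl.
  by move=> t [Qt ta]; split=> //; split=> //; exact: mltW.
have [Y [hY YE Y0]] := strand_surj hax.
have Ycycle : tor_cycle a Y.
  split=> //; case: d x hx bx Y hY hax YE Y0 => // d x hx bx Y hY hax YE Y0.
  apply/max_mulP => A; rewrite mcoeff0_strand strand_fdiff coeffZ.
  have [Aa|/Y0->] := eqVneq (chain_max A) a; last by rewrite linear0 coeff0 mulr0.
  rewrite Aa YE bnd_pcons bx linear0 subr0.
  rewrite (_ : coeff _ x = 0) ?mulr0 //; apply/eqP; apply: contraT => /hx[_ _ hA].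
  have [t At] := chain_seq_cons A.
  have [|_] := hA a; first by rewrite At Aa mem_head.
  by rewrite mgt_irr.
have [n dim_n] := tor_has_dim d a.
have [n0|n0] := eqVneq n 0%N; last first.
  by case: nBa; exists d, n; split; [exists F | exact/eqP].
rewrite {n}n0 in dim_n; have [v [_ _ /(_ Y Ycycle)[c]]] := dim_n.
rewrite big_ord0 subr0 => -[y [z [/max_mulP z0 YE']]].
(* The error term [z] has no constant coefficients, hence no chain with maximum [a] in its strand of
   degree [a]. *)
have az0 : hd a (strand a z) = 0.
  apply/freegP => t; rewrite coeff_hd coeff0.
  have [[A At]|sA] := pselect (exists A : chain Q d, a :: t = chain_seq A); last first.
    by rewrite coeff_strand0.
  have [t' At'] := chain_seq_cons A.
  have Aa : chain_max A = a by move: At; rewrite At' => -[].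
  by rewrite At -Aa -mcoeff0_strand z0.
have hy := @supp_strand _ _ _ a _ y.
(* Applying [hd a] to the strand of [Y] recovers [x]; the two signs come from [strand_fdiff] and
   [hd_bnd]. *)
exists (- ((-1) ^+ d.+1 *: hd a (strand a y))); split.
  apply: suppN; apply: suppZ; apply: suppS (supp_hd (@mgt_trans m) (a := a) hy).
  by apply: dchainS => t [[Qt _] ta].
have amax t : [set t | Q t /\ mle t a] t -> ~~ mgt t a by case=> _; exact: not_mgt_le.
rewrite linearN linearZ /= -scalerN -(hd_bnd (@mgt_irr m) (@mgt_trans m) amax hy).
have := congr1 (hd a) YE; rewrite hd_pcons => <-.
by rewrite YE' raddfD /= strand_fdiff linearD linearZ /= az0 addr0.
Qed.

End Tor.

(** * Comparison of [P] with deg I *)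

Theorem theorem5p1 (k : fieldType) (m : nat) (I : set {mpoly k[m]})
    (P : set {ffun 'I_m -> int}) :
  monomial_ideal I ->
  betti_poset I `<=` P -> P `<=` ideal_deg I ->
  supports_free_resolution P I.
Proof.
move=> monI BP PI; apply: acyclic_free_resolution => // g Ig n z hz bz.
have [D hD] := ideal_deg_finite monI g.
have DE : [set t | P t /\ t \in D] = [set t | P t /\ mle t g].
  apply/seteqP; split=> t [Pt]; first by move=> /hD[].
  by move=> tg; split=> //; apply/hD; split => //; exact: PI.
have DE' : [set` D] = [set t | ideal_deg I t /\ mle t g].
  by apply/seteqP; split=> t /= /hD.
have hz' : supp (dchain (@mgt m) n [set t | ideal_deg I t /\ mle t g]) z.
  by apply: suppS hz; apply: dchainS => t [/PI].
(* The cycle [z] of [P] bounds [w] in the cone of degrees of [I] below [g]. As the boundary of [w]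
   lies in [P], [w] can be moved into [P] by a boundary, still bounding [z]. *)
have [w [hw zE]] := ideal_deg_acyclic Ig hz' bz.
have [|||||y [_]] := relative_acyclic (@mgt_irr m) (@mgt_trans m) (P := P)
    (Q := ideal_deg I) (D := D) (n := n.+1) (x := w) _ _ _ _ _.
- move=> q Iq nPq; apply: (betti_acyclic monI Iq) => /BP.
  exact: nPq.
- by move=> d /hD[].
- move=> d e /hD[_ dg] Ie de; apply/hD; split=> //.
  exact: mle_trans (mltW de) dg.
- by rewrite DE'.
- by rewrite DE -zE.
rewrite DE => hy; exists (w - bnd y); split=> //.
by rewrite linearB /= bndK subr0.
Qed.
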